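(* Let $M$ be an invariant submanifold of an $(LCS)_n$-manifold $\widetilde{M}$ admitting quarter symmetric metric connection, and suppose $\alpha\neq1$ (at every point). Then the following statements are equivalent: (1) $\sigma$ is recurrent with respect to the quarter symmetric metric connection. (2) $\sigma$ is 2-recurrent with respect to the quarter symmetric metric connection. (3) $\sigma$ is generalized 2-recurrent with respect to the quarter symmetric metric connection. (4) $M$ has parallel third fundamental form with respect to the quarter symmetric metric connection. (5) $M$ is totally geodesic with respect to the Levi-Civita connection.
   Context: An $(LCS)_n$-manifold (Lorentzian concircular structure manifold) is an $n$-dimensional Lorentzian manifold $(\widetilde{M},g)$, signature $(-,+,\dots,+)$, with Levi-Civita connection $\widetilde{\nabla}$, together with a unit timelike vector field $\xi$ (so $g(\xi,\xi)=-1$), the 1-form $\eta(X)=g(X,\xi)$, and a nowhere zero smooth function $\alpha$ such that $\widetilde{\nabla}_X\xi=\alpha\{X+\eta(X)\xi\}$, equivalently $(\widetilde{\nabla}_X\eta)(Y)=\alpha\{g(X,Y)+\eta(X)\eta(Y)\}$, and $X\alpha=\rho\,\eta(X)$ for all $X$, where $\rho=-(\xi\alpha)$. The structure tensor is the $(1,1)$ tensor $\phi X=\frac1\alpha\widetilde{\nabla}_X\xi=X+\eta(X)\xi$. The quarter symmetric metric connection on $\widetilde{M}$ is $\overline{\widetilde{\nabla}}_XY=\widetilde{\nabla}_XY+\eta(Y)\phi X-g(\phi X,Y)\xi$. A submanifold $M$ of dimension $m<n$ with induced metric (also denoted $g$) is invariant if $\xi$ is tangent to $M$ at every point of $M$ and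 $\phi(TM)\subset TM$. For $X,Y$ tangent to $M$: $\widetilde{\nabla}_XY=\nabla_XY+\sigma(X,Y)$ (tangential and normal parts), where $\sigma$ is the second fundamental form; $\overline{\nabla}_XY$ is the tangential part of $\overline{\widetilde{\nabla}}_XY$; and for $V$ normal, $\overline{\nabla}^\perp_XV$ is the normal part of $\overline{\widetilde{\nabla}}_XV$. $M$ is totally geodesic with respect to the Levi-Civita connection if $\sigma=0$. First and second covariant derivatives of $\sigma$ with respect to the quarter symmetric metric connection, for vector fields $X,Y,Z,W$ tangent to $M$: $(\overline{\widetilde{\nabla}}_X\sigma)(Y,Z)=\overline{\nabla}^\perp_X(\sigma(Y,Z))-\sigma(\overline{\nabla}_XY,Z)-\sigma(Y,\overline{\nabla}_XZ)$, $(\overline{\widetilde{\nabla}}_X\overline{\widetilde{\nabla}}_Y\sigma)(Z,W)=\overline{\nabla}^\perp_X((\overline{\widetilde{\nabla}}_Y\sigma)(Z,W))-(\overline{\widetilde{\nabla}}_Y\sigma)(\overline{\nabla}_XZ,W)-(\overline{\widetilde{\nabla}}_X\sigma)(Z,\overline{\nabla}_YW)-(\overline{\widetilde{\nabla}}_{\overline{\nabla}_XY}\sigma)(Z,W)$. With respect to the quarter symmetric metric connection (conditions for all vector fields $X,Y,Z,W$ tangent to $M$): $\sigma$ is recurrent if $(\overline{\widetilde{\nabla}}_X\sigma)(Y,Z)=\pi(X)\sigma(Y,Z)$ for some 1-form $\pi$ on $M$; $\sigma$ is 2-recurrent if $(\overline{\widetilde{\nabla}}_X\overline{\widetilde{\nabla}}_Y\sigma)(Z,W)=\psi(X,Y)\sigma(Z,W)$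 for some $(0,2)$-tensor field $\psi$ on $M$; $\sigma$ is generalized 2-recurrent if $(\overline{\widetilde{\nabla}}_X\overline{\widetilde{\nabla}}_Y\sigma)(Z,W)=\psi(X,Y)\sigma(Z,W)+\pi(X)(\overline{\widetilde{\nabla}}_Y\sigma)(Z,W)$ for some $(0,2)$-tensor field $\psi$ and 1-form $\pi$ on $M$; $M$ has parallel third fundamental form if $(\overline{\widetilde{\nabla}}_X\overline{\widetilde{\nabla}}_Y\sigma)(Z,W)=0$. *)

(* Defs.v *)
From HB Require Import structures.
From mathcomp Require Import all_boot all_order all_algebra.
From mathcomp Require Import boolp classical_sets functions reals topology.
From mathcomp Require Import normedtype landau derive.
Set Implicit Arguments.
Unset Strict Implicit.
Unset Printing Implicit Defensive.
Import Order.TTheory GRing.Theory Num.Theory numFieldNormedType.Exports.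
Local Open Scope classical_set_scope.
Local Open Scope ring_scope.

Section Euclidean.
Context {R : realType}.

Fixpoint Ck n (k : nat) (A : set 'rV[R]_n) (f : 'rV[R]_n -> R) : Prop :=
  match k with
  | 0 => forall x, A x -> {for x, continuous f}
  | k'.+1 => (forall x, A x -> differentiable f x) /\
             (forall j : 'I_n, Ck k' A (fun x => 'D_(delta_mx ord0 j) f x))
  end.

Definition smooth_on n (A : set 'rV[R]_n) (f : 'rV[R]_n -> R) : Prop :=
  forall k, Ck k A f.

Lemma near_eq_differentiable n (f g : 'rV[R]_n -> R) x :
  (\near x, f x = g x) -> differentiable f x -> differentiable g x.
Proof.
move=> fg df; have [dc /eqaddoP dfx] := (diff_locallyP x f).1 df.
have fgx : f x = g x by exact: nbhs_singleton fg.
have fg0 : \forall h \near 0, f (h + x) = g (h + x).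
  by move/nbhs0P: fg; apply: filterS => h; rewrite addrC.
have dgx : g \o shift x = cst (g x) + 'd f x +o_ 0 id.
  apply/eqaddoP => e e0; have := dfx _ e0; apply: filterS2 fg0 => h fgh.
  by rewrite !fctE /= -fgh -fgx.
apply/diff_locallyP.
by have -> : 'd g x = 'd f x :> (_ -> _) by exact: diff_unique.
Qed.

Lemma near_open n (A : set 'rV[R]_n) (f g : 'rV[R]_n -> R) x :
  open A -> (forall x, A x -> f x = g x) -> A x -> \near x, f x = g x.
Proof.
move=> oA fg Ax; have : nbhs x A by exact: open_nbhs_nbhs.
by apply: filterS => y /fg.
Qed.

Lemma Ck_eq n k (A : set 'rV[R]_n) f g : open A ->
  (forall x, A x -> f x = g x) -> Ck k A f -> Ck k A g.
Proof.
move=> oA; elim: k f g => [|k IH] f g fg.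
  move=> fA x Ax; rewrite /prop_for /continuous_at -(fg _ Ax).
  apply: cvg_trans; last exact: fA.
  by apply: (@near_eq_cvg _ _ (nbhs x)); exact: near_open oA fg Ax.
move=> [df Df]; split.
  by move=> x Ax; apply: near_eq_differentiable (df x Ax); exact: near_open oA fg Ax.
move=> j; apply: (IH _ _ _ (Df j)) => x Ax.
by apply: near_eq_derive; exact: near_open oA fg Ax.
Qed.

Lemma Ck_sub n k (A B : set 'rV[R]_n) f : A `<=` B -> Ck k B f -> Ck k A f.
Proof.
move=> AB; elim: k f => [|k IH] f /=; first by move=> fB x /AB /fB.
by move=> [df Df]; split=> [x /AB /df //|j]; exact: IH.
Qed.

Lemma Ck_local n k (A : set 'rV[R]_n) f :
  (forall x, A x -> exists2 B, B x & Ck k B f) -> Ck k A f.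
Proof.
elim: k f => [|k IH] f /= fA; first by move=> x /fA [B Bx]; exact.
split=> [x /fA [B Bx [+ _]]|j]; first exact.
by apply: IH => x /fA [B Bx [_ /(_ j)]]; exists B.
Qed.

Lemma CkS n k (A : set 'rV[R]_n) f : Ck k.+1 A f -> Ck k A f.
Proof.
elim: k f => [|k IH] f [df Df]; first by move=> x /df/differentiable_continuous.
by split=> // j; exact/IH/Df.
Qed.

Lemma Ck_cst n k (A : set 'rV[R]_n) (a : R) : Ck k A (fun _ => a).
Proof.
elim: k a => [|k IH] a /=; first by move=> x _; exact: cst_continuous.
split=> [x _|j]; first exact: differentiable_cst.
by under eq_fun do rewrite derive_cst; exact: IH.
Qed.

Lemma CkD n k (A : set 'rV[R]_n) f g : open A ->
  Ck k A f -> Ck k A g -> Ck k A (fun x => f x + g x).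
Proof.
move=> oA; elim: k f g => [|k IH] f g /=.
  by move=> fA gA x Ax; apply: continuousD; [exact: fA|exact: gA].
move=> [df Df] [dg Dg]; split=> [x Ax|j].
  by apply: differentiableD; [exact: df|exact: dg].
apply: (Ck_eq oA _ (IH _ _ (Df j) (Dg j))) => x Ax.
by rewrite deriveD //; apply: diff_derivable; [exact: df|exact: dg].
Qed.

Lemma CkM n k (A : set 'rV[R]_n) f g : open A ->
  Ck k A f -> Ck k A g -> Ck k A (fun x => f x * g x).
Proof.
move=> oA; elim: k f g => [|k IH] f g.
  by move=> fA gA x Ax; apply: continuousM; [exact: fA|exact: gA].
move=> fk gk; have [df Df] := fk; have [dg Dg] := gk; split=> [x Ax|j].
  by apply: differentiableM; [exact: df|exact: dg].
have := CkD oA (IH _ _ (CkS fk) (Dg j)) (IH _ _ (CkS gk) (Df j)).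
apply: (Ck_eq oA) => x Ax.
by rewrite deriveM //; apply: diff_derivable; [exact: df|exact: dg].
Qed.

Lemma Ck_sum n k (A : set 'rV[R]_n) p (f : 'I_p -> 'rV[R]_n -> R) : open A ->
  (forall i, Ck k A (f i)) -> Ck k A (fun x => \sum_i f i x).
Proof.
move=> oA fA; elim: (index_enum _) => [|i s IH].
  by under eq_fun do rewrite big_nil; exact: Ck_cst.
by under eq_fun do rewrite big_cons; exact: CkD.
Qed.

Lemma differentiable_row m n (G : 'rV[R]_m -> 'rV[R]_n) x :
  (forall j, differentiable (fun y => G y ord0 j) x) -> differentiable G x.
Proof.
move=> dG.
have -> : G = \sum_j (fun y => G y ord0 j *: delta_mx ord0 j).
  by apply/funext => y; rewrite fct_sumE [LHS]row_sum_delta.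
by apply: differentiable_sum => j; exact: differentiableZl.
Qed.

Lemma derive_compE m n (G : 'rV[R]_m -> 'rV[R]_n) (f : 'rV[R]_n -> R) x v :
  differentiable G x -> differentiable f (G x) ->
  'D_v (f \o G) x = 'd f (G x) ('d G x v).
Proof.
move=> dG df; rewrite deriveE; last exact: differentiable_comp.
by have /(congr1 (fun h => h v)) := diff_comp dG df.
Qed.

Lemma derive_coord m n (G : 'rV[R]_m -> 'rV[R]_n) x v j :
  differentiable G x -> 'D_v (fun y => G y ord0 j) x = ('d G x v) ord0 j.
Proof.
move=> dG; pose c (y : 'rV[R]_n) : R := y ord0 j.
have clin : linear c by move=> a y z; rewrite /c !mxE.
pose cL : {linear 'rV[R]_n -> R} := HB.pack c (GRing.isLinear.Build _ _ _ _ _ clin).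
have cc : continuous cL by exact: coord_continuous.
have dc : differentiable cL (G x) by exact: linear_differentiable.
have dcE : 'd cL (G x) = cL :> (_ -> _) by exact: diff_lin.
by rewrite -[LHS]/('D_v (cL \o G) x) derive_compE // dcE.
Qed.

Lemma Ck_comp m n k (A : set 'rV[R]_m) (B : set 'rV[R]_n)
    (G : 'rV[R]_m -> 'rV[R]_n) f : open A -> (forall x, A x -> B (G x)) ->
  (forall x, A x -> {for x, continuous G}) ->
  (forall j, Ck k A (fun x => G x ord0 j)) -> Ck k B f ->
  Ck k A (fun x => f (G x)).
Proof.
move=> oA AB cG; elim: k f => [|k IH] f.
  move=> _ fB x Ax; apply: continuous_comp; first exact: cG.
  exact/fB/AB.
move=> GA [df Df].
have dG x : A x -> differentiable G x.
  by move=> Ax; apply: differentiable_row => j; have [+ _] := GA j; exact.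
split=> [x Ax|j].
  by apply: differentiable_comp; [exact: dG|exact/df/AB].
have Gk l : Ck k A (fun x => G x ord0 l) by exact/CkS/GA.
have GD l : Ck k A (fun x => 'D_(delta_mx ord0 j) (fun x => G x ord0 l) x).
  by have [_ +] := GA l; exact.
have := Ck_sum oA (fun l => CkM oA (GD l) (IH _ Gk (Df l))).
apply: (Ck_eq oA) => x Ax.
have dfG := df _ (AB _ Ax).
have -> : 'D_(delta_mx ord0 j) (f \o G) x =
    'd f (G x) ('d G x (delta_mx ord0 j)).
  by apply: derive_compE => //; exact: dG.
move: ('d G x _) (fun l => derive_coord (delta_mx ord0 j) l (dG _ Ax)) => v vE.
have -> : v = \sum_l v ord0 l *: delta_mx ord0 l by exact: row_sum_delta.
rewrite linear_sum; apply: eq_bigr => l _.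
by rewrite linearZ /= -deriveE // vE.
Qed.

End Euclidean.

(* Manifolds of dimension n without boundary, given by a smooth atlas. *)

Record chart (R : realType) (T : topologicalType) (n : nat) := Chart {
  chart_dom : set T;
  chart_img : set 'rV[R]_n;
  chart_fwd : T -> 'rV[R]_n;
  chart_bwd : 'rV[R]_n -> T;
  chart_dom_open : open chart_dom;
  chart_img_open : open chart_img;
  chart_fwd_img : forall p, chart_dom p -> chart_img (chart_fwd p);
  chart_bwd_dom : forall x, chart_img x -> chart_dom (chart_bwd x);
  chart_fwdK : forall p, chart_dom p -> chart_bwd (chart_fwd p) = p;
  chart_bwdK : forall x, chart_img x -> chart_fwd (chart_bwd x) = x;
  chart_fwd_cont : forall p, chart_dom p -> {for p, continuous chart_fwd};
  chart_bwd_cont : forall x, chart_img x -> {for x, continuous chart_bwd} }.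

Record manifold (R : realType) (n : nat) := Manifold {
  mpoint :> topologicalType;
  atlas : set (chart R mpoint n);
  mfd_hausdorff : hausdorff_space mpoint;
  mfd_second_countable : @second_countable mpoint;
  mfd_cover : forall p : mpoint, exists2 c, atlas c & chart_dom c p;
  mfd_compat : forall c c', atlas c -> atlas c' -> forall j : 'I_n,
    smooth_on (chart_img c `&` chart_bwd c @^-1` chart_dom c')
      (fun x => chart_fwd c' (chart_bwd c x) ord0 j) }.

Section Smooth.
Context {R : realType}.

Definition smooth n (M : manifold R n) (f : M -> R) : Prop :=
  forall c, atlas c -> smooth_on (chart_img c) (f \o chart_bwd c).

Definition smooth_map_def m n (M : manifold R m) (N : manifold R n)
    (F : M -> N) : Prop :=
  continuous F /\
  forall c c', atlas c -> atlas c' -> forall j : 'I_n,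
    smooth_on (chart_img c `&` (F \o chart_bwd c) @^-1` chart_dom c')
      (fun x => chart_fwd c' (F (chart_bwd c x)) ord0 j).

Lemma smooth_comp m n (M : manifold R m) (N : manifold R n) (F : M -> N) f :
  smooth_map_def F -> smooth f -> smooth (f \o F).
Proof.
move=> [cF sF] sf c ac k; apply: Ck_local => x cx.
have [c' ac' c'x] := mfd_cover (F (chart_bwd c x)).
pose A := chart_img c `&` (F \o chart_bwd c) @^-1` chart_dom c'.
have oA : open A.
  rewrite openE => y [cy Fy]; apply: filterI.
    by apply: open_nbhs_nbhs; split=> //; exact: chart_img_open.
  have : {for y, continuous (F \o chart_bwd c)}.
    by apply: continuous_comp; [exact: chart_bwd_cont|exact: cF].
  by apply; apply: open_nbhs_nbhs; split=> //; exact: chart_dom_open.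
exists A => //.
have := @Ck_comp R _ _ k A (chart_img c')
  (fun y => chart_fwd c' (F (chart_bwd c y))) (f \o chart_bwd c') oA.
move=> H; apply: (Ck_eq oA _ (H _ _ _ _)).
- by move=> y [_ Fy] /=; rewrite chart_fwdK.
- by move=> y [_ Fy]; exact: chart_fwd_img.
- move=> y [cy Fy]; apply: continuous_comp.
    by apply: continuous_comp; [exact: chart_bwd_cont|exact: cF].
  exact: chart_fwd_cont.
- by move=> j; exact: sF.
- exact: sf.
Qed.

Lemma smooth_cst n (M : manifold R n) (a : R) : smooth (fun _ : M => a).
Proof. by move=> c ac k; exact: Ck_cst. Qed.

Lemma smoothD n (M : manifold R n) (f g : M -> R) :
  smooth f -> smooth g -> smooth (fun p => f p + g p).
Proof.
by move=> sf sg c ac k; apply: CkD; [exact: chart_img_open|exact: sf|exact: sg].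
Qed.

Lemma smoothM n (M : manifold R n) (f g : M -> R) :
  smooth f -> smooth g -> smooth (fun p => f p * g p).
Proof.
by move=> sf sg c ac k; apply: CkM; [exact: chart_img_open|exact: sf|exact: sg].
Qed.

Record smooth_fun n (M : manifold R n) := SmoothFun {
  sfun :> M -> R;
  sfunP : smooth sfun }.

Record smooth_map m n (M : manifold R m) (N : manifold R n) := SmoothMap {
  smap :> M -> N;
  smapP : smooth_map_def smap }.

Definition sf_comb n (M : manifold R n) (a : R) (f h : smooth_fun M) :=
  SmoothFun (smoothD (smoothM (@smooth_cst n M a) (@sfunP n M f))
                     (@sfunP n M h)).

Definition sf_mul n (M : manifold R n) (f h : smooth_fun M) :=
  SmoothFun (smoothM (@sfunP n M f) (@sfunP n M h)).

Definition sf_comp m n (M : manifold R m) (N : manifold R n)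
    (f : smooth_fun N) (i : smooth_map M N) :=
  SmoothFun (smooth_comp (@smapP m n M N i) (@sfunP n N f)).

(* Tangent vectors at p are the derivations at p of the algebra of smooth
   functions, so all the tangent spaces of M are linear subspaces of the one
   space vect M.  Vectors based at different points are distinguished by
   tangent p only.                                                          *)

Definition vect n (M : manifold R n) := smooth_fun M -> R.

Definition tangent n (M : manifold R n) (p : M) : set (vect M) :=
  [set v | (forall a f h, v (sf_comb a f h) = a * v f + v h) /\
           (forall f h, v (sf_mul f h) = v f * h p + f p * v h)].

(* The smooth vector fields along F : M -> N; those on N itself are the
   fields along the identity, see vfield. *)
Definition field_along m n (M : manifold R m) (N : manifold R n) (F : M -> N)
    (V : M -> vect N) : Prop :=
  (forall p, tangent (F p) (V p)) /\
  (forall f : smooth_fun N, smooth (fun p => V p f)).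

Definition vfield n (N : manifold R n) (X : N -> vect N) : Prop :=
  field_along id X.

Definition push m n (M : manifold R m) (N : manifold R n) (i : smooth_map M N)
  (u : vect M) : vect N := fun f => u (sf_comp f i).

Definition immersion m n (M : manifold R m) (N : manifold R n)
    (i : smooth_map M N) : Prop :=
  forall p (u v : vect M), tangent p u -> tangent p v ->
    push i u = push i v -> u = v.

End Smooth.

Section Lorentz.
Context {R : realType} {n : nat} {N : manifold R n}.

Definition linear_on (A : set (vect N)) (l : vect N -> R) : Prop :=
  forall a u v, A u -> A v -> l (a *: u + v) = a * l u + l v.

Definition bilinear_on (A : set (vect N)) (b : vect N -> vect N -> R) : Prop :=
  (forall w, A w -> linear_on A (b w)) /\
  (forall w, A w -> linear_on A (b^~ w)).

Record lorentzian (g : N -> vect N -> vect N -> R) : Prop := Lorentzian {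
  lor_dim : (0 < n)%N;
  lor_bilinear : forall q, bilinear_on (tangent q) (g q);
  lor_sym : forall q u v, tangent q u -> tangent q v -> g q u v = g q v u;
  lor_smooth : forall X Y, vfield X -> vfield Y ->
    smooth (fun q => g q (X q) (Y q));
  lor_signature : forall q, exists e : 'I_n -> vect N,
    [/\ forall i, tangent q (e i),
        forall v, tangent q v -> exists c : 'I_n -> R, v = \sum_i c i *: e i &
        forall i j, g q (e i) (e j) =
          if i == j then (if i == 0%N :> nat then -1 else 1) else 0] }.

(* nabla q v Y is the covariant derivative of the field Y in the direction of
   the tangent vector v at q; its values are constrained only there. *)
Record connection (nabla : N -> vect N -> (N -> vect N) -> vect N) : Prop :=
  Connection {
  conn_field : forall X Y, vfield X -> vfield Y ->
    vfield (fun q => nabla q (X q) Y);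
  conn_tangent : forall q v Y, tangent q v -> vfield Y ->
    tangent q (nabla q v Y);
  conn_linear : forall q a u v Y, tangent q u -> tangent q v -> vfield Y ->
    nabla q (a *: u + v) Y = a *: nabla q u Y + nabla q v Y;
  conn_add : forall q v Y Z, tangent q v -> vfield Y -> vfield Z ->
    nabla q v (fun x => Y x + Z x) = nabla q v Y + nabla q v Z;
  conn_leibniz : forall q v (f : smooth_fun N) Y, tangent q v -> vfield Y ->
    nabla q v (fun x => f x *: Y x) = v f *: Y q + f q *: nabla q v Y }.

Record levi_civita (g : N -> vect N -> vect N -> R)
    (nabla : N -> vect N -> (N -> vect N) -> vect N) : Prop := LeviCivita {
  lc_connection : connection nabla;
  lc_metric : forall q v Y Z (gYZ : smooth_fun N),
    tangent q v -> vfield Y -> vfield Z ->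
    (forall x, gYZ x = g x (Y x) (Z x)) ->
    v gYZ = g q (nabla q v Y) (Z q) + g q (Y q) (nabla q v Z);
  lc_torsion_free : forall X Y (f Xf Yf : smooth_fun N) q,
    vfield X -> vfield Y ->
    (forall x, Xf x = X x f) -> (forall x, Yf x = Y x f) ->
    nabla q (X q) Y f - nabla q (Y q) X f = X q Yf - Y q Xf }.

Record lcs_structure (g : N -> vect N -> vect N -> R)
    (nabla : N -> vect N -> (N -> vect N) -> vect N)
    (xi : N -> vect N) (alpha : smooth_fun N) : Prop := LCSStructure {
  lcs_lorentzian : lorentzian g;
  lcs_levi_civita : levi_civita g nabla;
  lcs_xi_field : vfield xi;
  lcs_xi_unit : forall q, g q (xi q) (xi q) = -1;
  lcs_alpha_neq0 : forall q, alpha q != 0;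
  lcs_nabla_xi : forall q v, tangent q v ->
    nabla q v xi = alpha q *: (v + g q v (xi q) *: xi q);
  lcs_d_alpha : forall q v, tangent q v ->
    v alpha = - xi q alpha * g q v (xi q) }.

Definition structure_tensor (nabla : N -> vect N -> (N -> vect N) -> vect N)
    (xi : N -> vect N) (alpha : smooth_fun N) (q : N) (v : vect N) : vect N :=
  (alpha q)^-1 *: nabla q v xi.

(* The difference between the quarter symmetric metric connection and the
   Levi-Civita connection; it is tensorial, hence also defines the quarter
   symmetric connection on fields along a submanifold (see quarter_along). *)
Definition quarter_diff (g : N -> vect N -> vect N -> R)
    (nabla : N -> vect N -> (N -> vect N) -> vect N)
    (xi : N -> vect N) (alpha : smooth_fun N) (q : N) (v y : vect N) : vect N :=
  let phi := structure_tensor nabla xi alpha q in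
  g q y (xi q) *: phi v - g q (phi v) y *: xi q.

Definition quarter_connection (g : N -> vect N -> vect N -> R)
    (nabla : N -> vect N -> (N -> vect N) -> vect N)
    (xi : N -> vect N) (alpha : smooth_fun N) (q : N) (v : vect N)
    (Y : N -> vect N) : vect N :=
  nabla q v Y + quarter_diff g nabla xi alpha q v (Y q).

End Lorentz.

(* Immersed submanifolds i : M -> N.  T_pM is identified with its image in
   T_(i p) N, and a vector field tangent to M is a field along i with values
   in these images. *)
Section Submanifold.
Context {R : realType} {m n : nat} {M : manifold R m} {N : manifold R n}.
Context (i : smooth_map M N).

Definition tspace (p : M) : set (vect N) := push i @` tangent p.

Definition tangent_field (X : M -> vect N) : Prop :=
  field_along i X /\ (forall p, tspace p (X p)).

Definition one_form (pi : M -> vect N -> R) : Prop :=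
  (forall p, linear_on (tspace p) (pi p)) /\
  (forall X, tangent_field X -> smooth (fun p => pi p (X p))).

Definition two_tensor (psi : M -> vect N -> vect N -> R) : Prop :=
  (forall p, bilinear_on (tspace p) (psi p)) /\
  (forall X Y, tangent_field X -> tangent_field Y ->
     smooth (fun p => psi p (X p) (Y p))).

(* i makes M a semi-Riemannian submanifold: the induced metric, the pullback of
   g, is a metric tensor on M. *)
Definition semi_riemannian_submanifold (g : N -> vect N -> vect N -> R) : Prop :=
  [/\ immersion i, two_tensor (fun p => g (i p)) &
      forall p v, tspace p v -> (forall w, tspace p w -> g (i p) v w = 0) ->
        v = 0].

(* D is the connection induced by nabla on the fields along i, i.e. the
   pullback connection: D p v V differentiates V in the direction of v in T_pM.
   It is determined by nabla, and gives a meaning to nabla_X Y when X and Y are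
   only defined along M. *)
Record induced_connection (nabla : N -> vect N -> (N -> vect N) -> vect N)
    (D : M -> vect N -> (M -> vect N) -> vect N) : Prop := InducedConnection {
  ind_field : forall X V, tangent_field X -> field_along i V ->
    field_along i (fun p => D p (X p) V);
  ind_tangent : forall p v V, tspace p v -> field_along i V ->
    tangent (i p) (D p v V);
  ind_linear : forall p a u v V, tspace p u -> tspace p v -> field_along i V ->
    D p (a *: u + v) V = a *: D p u V + D p v V;
  ind_add : forall p v V W, tspace p v -> field_along i V -> field_along i W ->
    D p v (fun x => V x + W x) = D p v V + D p v W;
  ind_leibniz : forall p u (f : smooth_fun M) V,
    tangent p u -> field_along i V ->
    D p (push i u) (fun x => f x *: V x) =
      u f *: V p + f p *: D p (push i u) V;
  ind_restrict : forall p v Y, tspace p v -> vfield Y ->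
    D p v (Y \o i) = nabla (i p) v Y }.

Context (g : N -> vect N -> vect N -> R)
          (nabla : N -> vect N -> (N -> vect N) -> vect N)
          (xi : N -> vect N) (alpha : smooth_fun N)
          (D : M -> vect N -> (M -> vect N) -> vect N).

Definition invariant_submanifold : Prop :=
  (forall p, tspace p (xi (i p))) /\
  (forall p v, tspace p v ->
     tspace p (structure_tensor nabla xi alpha (i p) v)).

Definition tan_part (p : M) (w : vect N) : vect N :=
  xget 0 [set t | tspace p t /\ forall s, tspace p s -> g (i p) (w - t) s = 0].

Definition nor_part (p : M) (w : vect N) : vect N := w - tan_part p w.

Definition quarter_along (p : M) (v : vect N) (V : M -> vect N) : vect N :=
  D p v V + quarter_diff g nabla xi alpha (i p) v (V p).

Lemma quarter_along_restrict p v Y : induced_connection nabla D ->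
  tspace p v -> vfield Y ->
  quarter_along p v (Y \o i) = quarter_connection g nabla xi alpha (i p) v Y.
Proof. by move=> iD pv vY; rewrite /quarter_along (ind_restrict iD). Qed.

(* Second fundamental form of M for the Levi-Civita connection. *)
Definition sff (X Y : M -> vect N) : M -> vect N :=
  fun p => nor_part p (D p (X p) Y).

(* Tangential and normal connections of the quarter symmetric connection. *)
Definition qnabla (X Y : M -> vect N) : M -> vect N :=
  fun p => tan_part p (quarter_along p (X p) Y).

Definition qnabla_perp (X V : M -> vect N) : M -> vect N :=
  fun p => nor_part p (quarter_along p (X p) V).

Definition dsff (X Y Z : M -> vect N) : M -> vect N := fun p =>
  qnabla_perp X (sff Y Z) p - sff (qnabla X Y) Z p - sff Y (qnabla X Z) p.

(* The third term is the derivative along X evaluated at (Z, qnabla Y W); it is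
   not the Leibniz term (dsff Y) (Z, qnabla X W). *)
Definition d2sff (X Y Z W : M -> vect N) : M -> vect N := fun p =>
  qnabla_perp X (dsff Y Z W) p - dsff Y (qnabla X Z) W p
  - dsff X Z (qnabla Y W) p - dsff (qnabla X Y) Z W p.

Definition recurrent : Prop :=
  exists2 pi, one_form pi &
  forall X Y Z, tangent_field X -> tangent_field Y -> tangent_field Z ->
  forall p, dsff X Y Z p = pi p (X p) *: sff Y Z p.

Definition two_recurrent : Prop :=
  exists2 psi, two_tensor psi &
  forall X Y Z W, tangent_field X -> tangent_field Y ->
  tangent_field Z -> tangent_field W ->
  forall p, d2sff X Y Z W p = psi p (X p) (Y p) *: sff Z W p.

Definition generalized_two_recurrent : Prop :=
  exists psi pi, [/\ two_tensor psi, one_form pi &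
  forall X Y Z W, tangent_field X -> tangent_field Y ->
  tangent_field Z -> tangent_field W ->
  forall p, d2sff X Y Z W p =
    psi p (X p) (Y p) *: sff Z W p + pi p (X p) *: dsff Y Z W p].

Definition parallel_third_fundamental_form : Prop :=
  forall X Y Z W, tangent_field X -> tangent_field Y ->
  tangent_field Z -> tangent_field W ->
  forall p, d2sff X Y Z W p = 0.

Definition totally_geodesic : Prop :=
  forall X Y, tangent_field X -> tangent_field Y -> forall p, sff X Y p = 0.

End Submanifold.

(* Main.v *)
(** Everything rests on evaluating the covariant derivatives of sigma on [xi].
    Since [D_X xi = alpha phi X] is tangent to [M], [sigma(X, xi) = 0], and the
    quarter symmetric connection gives [nabla_X xi = (alpha - 1) phi X].  Hence
    [(nabla_X sigma)(Z, xi) = - (alpha - 1) sigma(Z, X)], while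
    [(nabla_X nabla_xi sigma)(Z, xi) = (alpha - 1)^2 sigma(Z, X)] because
    [nabla_xi xi = 0].  Each recurrence condition makes the relevant left-hand
    side vanish.  A normal part vanishes exactly on tangent vectors, so neither
    the existence nor the smoothness of the orthogonal projection onto [TM] is
    needed, nor the symmetry of sigma. *)
Require Import Defs.
From mathcomp Require Import all_boot all_order all_algebra.
From mathcomp Require Import reals topology.
From mathcomp Require Import boolp classical_sets functions normedtype.
From mathcomp Require Import ring.
Set Implicit Arguments.
Unset Strict Implicit.
Unset Printing Implicit Defensive.
Import GRing.Theory numFieldNormedType.Exports.
Local Open Scope ring_scope.

(** By proof irrelevance. It identifies the pullback of a product or combination with that of the
    pullbacks: the two differ only in their smoothness proofs. *)
Lemma smooth_fun_eq (R : realType) n (M : manifold R n) (f h : smooth_fun M) :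
  (f : M -> R) = h -> f = h.
Proof.
case: f h => f sf [h sh] /= fh; case: _ / fh in sh *.
by congr SmoothFun; exact: Prop_irrelevance.
Qed.

Section TangentSpaces.
Context {R : realType} {m n : nat} {M : manifold R m} {N : manifold R n}.
Context (i : smooth_map M N).

Lemma tangent_comb (q : N) (a : R) (u v : vect N) :
  tangent q u -> tangent q v -> tangent q (a *: u + v).
Proof.
move=> [u1 u2] [v1 v2]; split=> [b f h|f h].
  rewrite !fctE /= u1 v1 /GRing.scale /=; ring.
rewrite !fctE /= u2 v2 /GRing.scale /=; ring.
Qed.

Lemma tangent0 p : tangent p (0 : vect M).
Proof.
have zE (f : smooth_fun M) : (0 : vect M) f = 0 by [].
by split=> [a f h|f h]; rewrite !zE; ring.
Qed.

Lemma push_tangent p (u : vect M) : tangent p u -> tangent (i p) (push i u).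
Proof.
move=> [u1 u2]; split=> [a f h|f h]; rewrite /push.
  by rewrite -u1; congr (u _); exact: smooth_fun_eq.
by rewrite -[RHS](u2 (sf_comp f i) (sf_comp h i)); congr (u _); exact: smooth_fun_eq.
Qed.
End TangentSpaces.

(** * Linear algebra of the tangent spaces of [M] and of its tangent fields *)

Section TangentSpaceOfSubmanifold.
Context {R : realType} {m n : nat} {M : manifold R m} {N : manifold R n}.
Context (i : smooth_map M N).

Lemma tspace_tangent p v : tspace i p v -> tangent (i p) v.
Proof. by move=> [u pu <-]; exact: push_tangent. Qed.

Lemma tspace_comb p (a : R) u v :
  tspace i p u -> tspace i p v -> tspace i p (a *: u + v).
Proof.
by move=> [u' pu <-] [v' pv <-]; exists (a *: u' + v') => //; exact: tangent_comb.
Qed.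

Lemma tspace0 p : tspace i p 0.
Proof. by exists 0; [exact: tangent0|]. Qed.

Lemma tspaceZ p (a : R) u : tspace i p u -> tspace i p (a *: u).
Proof. by move=> pu; rewrite -[_ *: u]addr0; exact: tspace_comb (tspace0 p). Qed.

Lemma tspaceD p u v : tspace i p u -> tspace i p v -> tspace i p (u + v).
Proof. by move=> pu pv; rewrite -[u]scale1r; exact: tspace_comb. Qed.

Lemma tspaceB p u v : tspace i p u -> tspace i p v -> tspace i p (u - v).
Proof. by move=> pu pv; rewrite addrC -scaleN1r; exact: tspace_comb. Qed.

Lemma tspace_addrI p u v : tspace i p u -> tspace i p (u + v) -> tspace i p v.
Proof. by move=> pu /tspaceB /(_ pu); rewrite addrAC subrr add0r. Qed.

Lemma tspace_scaleI p (a : R) u : a != 0 -> tspace i p (a *: u) -> tspace i p u.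
Proof. by move=> a0 /(tspaceZ a^-1); rewrite scalerA mulVf// scale1r. Qed.

Lemma tangent_field_comb (f : M -> R) X Y : smooth f ->
  tangent_field i X -> tangent_field i Y ->
  tangent_field i (fun p => f p *: X p + Y p).
Proof.
move=> sf [[X1 X2] X3] [[Y1 Y2] Y3]; split; last first.
  by move=> p; exact: tspace_comb.
split=> [p|h]; first exact: tangent_comb.
by have := smoothD (smoothM sf (X2 h)) (Y2 h).
Qed.

Lemma tangent_field0 : tangent_field i (fun=> 0).
Proof.
split=> [|p]; last exact: tspace0.
by split=> [p|h]; [exact: tangent0|exact: smooth_cst].
Qed.

Lemma tangent_fieldZ (f : M -> R) X : smooth f -> tangent_field i X ->
  tangent_field i (fun p => f p *: X p).
Proof.
move=> sf tX; have := tangent_field_comb sf tX tangent_field0.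
by under eq_fun do rewrite addr0.
Qed.

Lemma one_form0 : one_form i (fun _ _ => 0).
Proof.
split=> [p a u v _ _|X _]; last exact: smooth_cst.
by rewrite mulr0 addr0.
Qed.

Lemma two_tensor0 : two_tensor i (fun _ _ _ => 0).
Proof.
split=> [p|X Y _ _]; last exact: smooth_cst.
by split=> w _ a u v _ _; rewrite mulr0 addr0.
Qed.

End TangentSpaceOfSubmanifold.

Section InvariantSubmanifold.
Context {R : realType} {m n : nat} {M : manifold R m} {N : manifold R n}.
Context (g : N -> vect N -> vect N -> R)
  (nabla : N -> vect N -> (N -> vect N) -> vect N)
  (xi : N -> vect N) (alpha : smooth_fun N) (i : smooth_map M N)
  (D : M -> vect N -> (M -> vect N) -> vect N).
Context (lcs : lcs_structure g nabla xi alpha)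
  (subM : semi_riemannian_submanifold i g)
  (indD : induced_connection i nabla D)
  (invM : invariant_submanifold i nabla xi alpha)
  (alpha1 : forall q, alpha q <> 1).

Local Notation tspace := (tspace i).
Local Notation tfield := (tangent_field i).
Local Notation nor := (nor_part i g).
Local Notation sff := (sff i g D).
Local Notation qnabla := (qnabla i g nabla xi alpha D).
Local Notation qnabla_perp := (qnabla_perp i g nabla xi alpha D).
Local Notation dsff := (dsff i g nabla xi alpha D).
Local Notation d2sff := (d2sff i g nabla xi alpha D).
Local Notation qdiff := (quarter_diff g nabla xi alpha).
Let xiM : M -> vect N := xi \o i.
Let phi (X : M -> vect N) p : vect N := X p + g (i p) (X p) (xiM p) *: xiM p.

(** * Induced metric and tangential projection *)

Lemma metricDl p (a : R) u v w : tspace p u -> tspace p v -> tspace p w ->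
  g (i p) (a *: u + v) w = a * g (i p) u w + g (i p) v w.
Proof.
move=> pu pv pw; have [_ [/(_ p) [_ bg] _] _] := subM.
exact: bg.
Qed.

Lemma metric0l p w : tspace p w -> g (i p) 0 w = 0.
Proof.
move=> pw; have := metricDl 1 (tspace0 i p) (tspace0 i p) pw.
by rewrite scaler0 addr0 mul1r => /eqP; rewrite -subr_eq subrr eq_sym => /eqP.
Qed.

Lemma metric0r p w : tspace p w -> g (i p) w 0 = 0.
Proof.
move=> pw; rewrite (lor_sym (lcs_lorentzian lcs)) ?metric0l //.
  exact: tspace_tangent.
exact/tspace_tangent/tspace0.
Qed.

(** [w] is itself a candidate for [xget], and the induced metric is nondegenerate, so any two
    candidates coincide. *)
Lemma tan_part_id p w : tspace p w -> tan_part i g p w = w.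
Proof.
move=> pw; rewrite /tan_part; case: xgetP => [t _ [pt wt]|/(_ w) []].
  have [_ _ nd] := subM.
  by apply/esym/eqP; rewrite -subr_eq0; apply/eqP/(nd p) => //; exact: tspaceB.
by split=> // s ps; rewrite subrr metric0l.
Qed.

(** The default value 0 of [xget] is tangent too. *)
Lemma tan_part_tspace p w : tspace p (tan_part i g p w).
Proof.
by rewrite /tan_part; case: xgetP => [t _ []|_] //; exact: tspace0.
Qed.

(** Turns each vanishing of a normal part into a tangency, where the closure of [tspace] under
    linear combinations applies. *)
Lemma nor_part_eq0 p w : nor p w = 0 <-> tspace p w.
Proof.
split=> [/eqP|/tan_part_id pw]; last by rewrite /nor_part pw subrr.
by rewrite subr_eq0 => /eqP ->; exact: tan_part_tspace.
Qed.

(** * The field [xi], the tensor [phi] and the quarter symmetric correction along [M] *)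

Lemma xiM_tspace p : tspace p (xiM p).
Proof. by have [+ _] := invM; exact. Qed.

Lemma xiM_field : tfield xiM.
Proof.
split; last exact: xiM_tspace.
have [xt xs] := lcs_xi_field lcs; split=> [p|f]; first exact: xt.
exact: (smooth_comp (smapP i) (xs f)).
Qed.

Lemma phi_tspace X p : tspace p (X p) -> tspace p (phi X p).
Proof.
by move=> pX; rewrite /phi addrC; apply: tspace_comb => //; exact: xiM_tspace.
Qed.

Lemma metric_smooth X Y : tfield X -> tfield Y ->
  smooth (fun p => g (i p) (X p) (Y p)).
Proof. by have [_ [_ +] _] := subM; exact. Qed.

Lemma phi_field X : tfield X -> tfield (phi X).
Proof.
move=> tX; have := tangent_field_comb (metric_smooth tX xiM_field) xiM_field tX.
by congr tangent_field; apply/funext => p; rewrite addrC.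
Qed.

Lemma phi_xi p : phi xiM p = 0.
Proof. by rewrite /phi (lcs_xi_unit lcs) scaleN1r subrr. Qed.

Lemma structure_tensorE p X : tspace p (X p) ->
  structure_tensor nabla xi alpha (i p) (X p) = phi X p.
Proof.
move=> pX; rewrite /structure_tensor (lcs_nabla_xi lcs (tspace_tangent pX)).
by rewrite scalerA mulVf ?scale1r //; exact: lcs_alpha_neq0 lcs _.
Qed.

Lemma qdiffE p X y : tspace p (X p) -> qdiff (i p) (X p) y =
  g (i p) y (xiM p) *: phi X p - g (i p) (phi X p) y *: xiM p.
Proof. by move=> pX; rewrite /quarter_diff structure_tensorE. Qed.

Lemma qdiff_tspace p X y : tspace p (X p) -> tspace p (qdiff (i p) (X p) y).
Proof.
move=> pX; rewrite qdiffE //.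
apply: tspaceB; apply: tspaceZ; first exact: phi_tspace.
exact: xiM_tspace.
Qed.

Lemma qdiff0 p X : tspace p (X p) -> qdiff (i p) (X p) 0 = 0.
Proof.
move=> pX; rewrite qdiffE // metric0l ?metric0r ?scale0r ?subrr //.
  exact: phi_tspace.
exact: xiM_tspace.
Qed.

(** * Connections and sigma evaluated at [xi] and at the zero field *)

Lemma induced0 p v : tspace p v -> D p v (fun=> 0) = 0.
Proof.
move=> pv; have [f0 _] := tangent_field0 i.
have := ind_add indD pv f0 f0.
under eq_fun do rewrite addr0.
by move/eqP; rewrite -subr_eq subrr eq_sym => /eqP.
Qed.

Lemma induced_xi p X : tspace p (X p) -> D p (X p) xiM = alpha (i p) *: phi X p.
Proof.
move=> pX; rewrite (ind_restrict indD pX); last exact: lcs_xi_field lcs.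
by rewrite (lcs_nabla_xi lcs) //; exact: tspace_tangent.
Qed.

Lemma sff_xi Z p : tspace p (Z p) -> sff Z xiM p = 0.
Proof.
move=> pZ; apply/nor_part_eq0; rewrite induced_xi //.
exact/tspaceZ/phi_tspace.
Qed.

Lemma sff0 Z p : tspace p (Z p) -> sff Z (fun=> 0) p = 0.
Proof. by move=> pZ; apply/nor_part_eq0; rewrite induced0 //; exact: tspace0. Qed.

Lemma qnabla_perp0 X p : tspace p (X p) -> qnabla_perp X (fun=> 0) p = 0.
Proof.
move=> pX; apply/nor_part_eq0; rewrite /quarter_along induced0 // qdiff0 //.
by rewrite addr0; exact: tspace0.
Qed.

Lemma qnabla_tspace X Y p : tspace p (qnabla X Y p).
Proof. exact: tan_part_tspace. Qed.

Lemma qnabla0 X : (forall p, tspace p (X p)) -> qnabla X (fun=> 0) = fun=> 0.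
Proof.
move=> tX; apply/funext => p; rewrite /qnabla /quarter_along.
by rewrite induced0 // qdiff0 // addr0 tan_part_id //; exact: tspace0.
Qed.

(** The coefficient collects [alpha] from [D_X xi] and -1 from the correction term
    [eta(xi) phi X]. *)
Lemma qnabla_xi X : (forall p, tspace p (X p)) ->
  qnabla X xiM = fun p => (alpha (i p) - 1) *: phi X p.
Proof.
move=> tX; apply/funext => p.
rewrite /qnabla /quarter_along induced_xi // qdiffE // (lcs_xi_unit lcs).
(* [phi X] is orthogonal to [xi] because [g(xi, xi) = -1]. *)
have -> : g (i p) (phi X p) (xiM p) = 0.
  rewrite /phi addrC metricDl // ?(lcs_xi_unit lcs); last 2 first.
  - exact: xiM_tspace.
  - exact: xiM_tspace.
  by rewrite mulrN1 addNr.
rewrite scale0r subr0 -scalerDl tan_part_id //.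
exact/tspaceZ/phi_tspace.
Qed.

Lemma smooth_alpha1 : smooth (fun p => alpha (i p) - 1).
Proof.
have := smoothD (smooth_comp (smapP i) (sfunP alpha)) (@smooth_cst R m M (-1)).
exact.
Qed.

Lemma qnabla_xi_field X : tfield X -> tfield (qnabla X xiM).
Proof.
move=> tX; rewrite qnabla_xi; last by case: tX.
exact: tangent_fieldZ smooth_alpha1 (phi_field tX).
Qed.

Lemma qnabla_xi_xi : qnabla xiM xiM = fun=> 0.
Proof.
rewrite qnabla_xi; last exact: xiM_tspace.
by apply/funext => p; rewrite phi_xi scaler0.
Qed.

(** The factor [b] is the derivative of [f] along [v]. Its value is left open: for tangent [V] the
    term [b *: V p] is tangent whatever [b] is. *)
Lemma induced_leibniz p v (f : M -> R) V : smooth f -> tspace p v ->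
  field_along i V -> exists b,
  D p v (fun x => f x *: V x) = b *: V p + f p *: D p v V.
Proof.
move=> sf [u pu <-] fV; exists (u (SmoothFun sf)).
exact: (ind_leibniz indD (SmoothFun sf) pu fV).
Qed.

(* As [D_Z xi] is tangent, [sigma(Z, (alpha - 1) phi X)] is
   [(alpha - 1) sigma(Z, X)], stated without the linearity of the normal part. *)
Lemma sff_qnabla_xi_eq0 Z X p : tfield Z -> tfield X ->
  sff Z (qnabla X xiM) p = 0 -> sff Z X p = 0.
Proof.
move=> [_ tZ] tX; have [fX pX] := tX; have pZ := tZ p.
rewrite qnabla_xi // => /nor_part_eq0.
have [fphi /(_ p) pphi] := phi_field tX.
have [b ->] := induced_leibniz smooth_alpha1 pZ fphi.
move=> /(tspace_addrI (tspaceZ b pphi)) /tspace_scaleI Dphi.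
have {}Dphi : tspace p (D p (Z p) (phi X)).
  by apply: Dphi; rewrite subr_eq0; apply/eqP; exact: alpha1.
(* It remains to split [phi X = X + eta(X) xi]: the derivative of [eta(X) xi] is a combination of
   [xi] and [phi Z], hence tangent, so [D_Z X] is tangent as well. *)
have sX := metric_smooth tX xiM_field; have [fxi /(_ p) pxi] := xiM_field.
have [fXxi _] := tangent_fieldZ sX xiM_field.
move: Dphi; rewrite (ind_add indD pZ fX fXxi) addrC.
have [c ->] := induced_leibniz sX pZ fxi.
rewrite induced_xi // => DX; apply/nor_part_eq0; apply: tspace_addrI DX.
by apply: tspaceD; apply: tspaceZ => //; exact/tspaceZ/phi_tspace.
Qed.

(** * Covariant derivatives of sigma evaluated at [xi] *)

Lemma sff_xi_fun Z : (forall p, tspace p (Z p)) -> sff Z xiM = fun=> 0.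
Proof. by move=> tZ; apply/funext => p; exact: sff_xi. Qed.

(** Tangency is asked pointwise, so that [qnabla X Z], not known to be smooth here, can be
    substituted for [Z]. *)
Lemma dsff_xi X Z p : (forall q, tspace q (X q)) -> (forall q, tspace q (Z q)) ->
  dsff X Z xiM p = - sff Z (qnabla X xiM) p.
Proof.
move=> tX tZ; rewrite /dsff sff_xi_fun // qnabla_perp0 // sff_xi ?subr0 ?sub0r //.
exact: qnabla_tspace.
Qed.

Lemma dsff_xi_xi Z : (forall q, tspace q (Z q)) -> dsff xiM Z xiM = fun=> 0.
Proof.
move=> tZ; apply/funext => p; rewrite dsff_xi //; last exact: xiM_tspace.
by rewrite qnabla_xi_xi sff0 ?oppr0.
Qed.

Lemma dsff0 X Z p : (forall q, tspace q (X q)) -> (forall q, tspace q (Z q)) ->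
  dsff X Z (fun=> 0) p = 0.
Proof.
move=> tX tZ; rewrite /dsff qnabla0 // !sff0 //; last exact: qnabla_tspace.
have -> : sff Z (fun=> 0) = fun=> 0 by apply/funext => q; exact: sff0.
by rewrite qnabla_perp0 // !subr0.
Qed.

(** The first two terms vanish by [dsff_xi_xi], the third because [nabla_xi xi = 0]; only the
    derivative along [qnabla X xiM] survives. *)
Lemma d2sff_xi_xi X Z p : tfield X -> tfield Z ->
  d2sff X xiM Z xiM p = sff Z (qnabla (qnabla X xiM) xiM) p.
Proof.
move=> [_ tX] [_ tZ]; rewrite /d2sff dsff_xi_xi // dsff_xi_xi; last first.
  exact: qnabla_tspace.
rewrite qnabla_xi_xi dsff0 // qnabla_perp0 // !subr0 sub0r.
rewrite dsff_xi ?opprK //; exact: qnabla_tspace.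
Qed.

Lemma totally_geodesic_of_dsff_xi :
  (forall X Z p, tfield X -> tfield Z -> dsff X Z xiM p = 0) ->
  totally_geodesic i g D.
Proof.
move=> dsff_eq0 Z X tZ tX p; apply: sff_qnabla_xi_eq0 => //.
have [_ pX] := tX; have [_ pZ] := tZ.
by apply/eqP; rewrite -oppr_eq0 -dsff_xi // dsff_eq0.
Qed.

Lemma totally_geodesic_of_d2sff_xi :
  (forall X Z p, tfield X -> tfield Z -> d2sff X xiM Z xiM p = 0) ->
  totally_geodesic i g D.
Proof.
move=> d2sff_eq0 Z X tZ tX p.
(* Each application strips one factor [alpha - 1]. *)
do 2 (apply: sff_qnabla_xi_eq0 => //); last by rewrite -d2sff_xi_xi // d2sff_eq0.
exact: qnabla_xi_field.
Qed.

(** * Vanishing of the derivatives of sigma on a totally geodesic [M] *)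

Section TotallyGeodesic.
Context (geoM : totally_geodesic i g D).

(** With sigma zero, [D_X Y] is tangent, so the projection acts as the identity and [qnabla X Y] is
    an explicit smooth expression. Hence [geoM] applies to sigma with [qnabla X Y] as an
    argument. *)
Lemma qnabla_field X Y : tfield X -> tfield Y -> tfield (qnabla X Y).
Proof.
move=> tX tY; have [fX pX] := tX; have [fY pY] := tY.
have tD : tfield (fun p => D p (X p) Y).
  split; first by have := ind_field indD tX fY.
  by move=> p; apply/nor_part_eq0; exact: geoM.
have tphi := phi_field tX.
have tq := tangent_field_comb (metric_smooth tY xiM_field) tphi tD.
have sm1 := smoothM (@smooth_cst R m M (-1)) (metric_smooth tphi tY).
have {}tq := tangent_field_comb sm1 xiM_field tq.
apply: (eq_ind _ tfield tq); apply/funext => p.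
rewrite /qnabla /quarter_along tan_part_id; last first.
  by have [_ /(_ p) pD] := tD; apply: tspaceD => //; exact: qdiff_tspace.
by rewrite qdiffE // mulN1r scaleNr addrC [_ + D _ _ _]addrC addrA.
Qed.

Lemma dsff_geo X Y Z : tfield X -> tfield Y -> tfield Z ->
  dsff X Y Z = fun=> 0.
Proof.
move=> tX tY tZ; apply/funext => p; rewrite /dsff.
have -> : sff Y Z = fun=> 0 by apply/funext => q; exact: geoM.
rewrite qnabla_perp0; last by case: tX.
by rewrite !geoM ?subr0 //; exact: qnabla_field.
Qed.

Lemma d2sff_geo X Y Z W p : tfield X -> tfield Y -> tfield Z -> tfield W ->
  d2sff X Y Z W p = 0.
Proof.
move=> tX tY tZ tW; rewrite /d2sff !dsff_geo ?qnabla_perp0 ?subr0 //;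
  by [exact: qnabla_field|case: tX].
Qed.

End TotallyGeodesic.
End InvariantSubmanifold.

Theorem theorem5p4 (R : realType) (m n : nat)
    (M : manifold R m) (N : manifold R n)
    (g : N -> vect N -> vect N -> R)
    (nabla : N -> vect N -> (N -> vect N) -> vect N)
    (xi : N -> vect N) (alpha : smooth_fun N)
    (i : smooth_map M N)
    (D : M -> vect N -> (M -> vect N) -> vect N) :
  lcs_structure g nabla xi alpha ->
  (m < n)%N ->
  semi_riemannian_submanifold i g ->
  induced_connection i nabla D ->
  invariant_submanifold i nabla xi alpha ->
  (forall q, alpha q <> 1) ->
  [<-> recurrent i g nabla xi alpha D;
       two_recurrent i g nabla xi alpha D;
       generalized_two_recurrent i g nabla xi alpha D;
       parallel_third_fundamental_form i g nabla xi alpha D;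
       totally_geodesic i g D].
Proof.
move=> lcs _ subM indD invM alpha1.
have txi := xiM_field lcs invM.
have sxi := sff_xi lcs subM indD invM.
have dxi := dsff_xi_xi lcs subM indD invM.
have geo1 := totally_geodesic_of_dsff_xi lcs subM indD invM alpha1.
have geo2 := totally_geodesic_of_d2sff_xi lcs subM indD invM alpha1.
have dgeo := dsff_geo lcs subM indD invM.
have d2geo := d2sff_geo lcs subM indD invM.
tfae=> [[pi _ rec]|[psi tpsi rec]|[psi [pi [_ _ rec]]]|par|geo].
(* Recurrence at [xi] already forces sigma to vanish, so the zero tensor serves as [psi]. *)
- exists (fun _ _ _ => 0); first exact: two_tensor0.
  move=> X Y Z W tX tY tZ tW p; rewrite scale0r d2geo //.
  apply: geo1 => {}X {}Z q {}tX {}tZ.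
  by rewrite rec // sxi ?scaler0 //; case: tZ.
- exists psi, (fun _ _ => 0); split=> //; first exact: one_form0.
  by move=> X Y Z W tX tY tZ tW p; rewrite rec // scale0r addr0.
- move=> X Y Z W tX tY tZ tW p; apply: d2geo => //.
  apply: geo2 => {}X {}Z q {}tX {}tZ; have [_ pZ] := tZ.
  (* At [Y = W = xi] both [sigma(Z, xi)] and [(nabla_xi sigma)(Z, xi)] are zero, whatever [psi] and
     [pi] are. *)
  by rewrite rec // sxi // dxi // !scaler0 addr0.
- by apply: geo2 => X Z q tX tZ; rewrite par.
- exists (fun _ _ => 0); first exact: one_form0.
  by move=> X Y Z tX tY tZ p; rewrite scale0r dgeo.
Qed.
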